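(* Consider the classic dyadic system with parameters $f>0$, $\nu\ge0$, $\beta>0$, $\gamma>0$. There exists a unique positive $l^2$ solution $Y$ which is stationary. Moreover: (i) if $\nu=0$, then $Y_n(t)=f\cdot 2^{-\frac{\beta}{3}(n+1)}$ for all $n\ge 0$; (ii) if $\nu>0$ and $3\gamma\ge 2\beta$, the stationary solution is conservative and regular, in the sense that for every real $s$, $\sum_n[2^{sn}Y_n(t)]^2<\infty$; (iii) if $\nu>0$ and $3\gamma<2\beta$, there exists $C>0$ such that for all $f>C$ the stationary solution is not regular and exhibits anomalous dissipation.
   Context: The classic dyadic system is $$Y_{-1}(t)\equiv f,\qquad \frac{d}{dt}Y_n=-\nu l_nY_n+k_nY_{n-1}^2-k_{n+1}Y_nY_{n+1},\quad n\ge0,$$ with $k_n=2^{\beta n}$, $l_n=2^{\gamma n}$. A componentwise solution is a family $Y=(Y_n)_{n\ge0}$ of continuously differentiable functions $Y_n:[0,\infty)\to\mathbb{R}$ satisfying all the equations. It is an $l^2$ solution if $\sum_{n\ge 0} Y_n^2(t)<\infty$ for all $t\ge0$, positive if $Y_n(t)\ge0$ for all $n\ge0$, $t\ge0$, and stationary if it is constant in time. Let $\mathcal{E}(t)=\sum_{n\ge0}Y_n^2(t)$. A positive $l^2$ solution is conservative in $[s,t]$, $0\le s<t$, if $$\mathcal{E}(t)=\mathcal{E}(s)+2f^2\int_s^tY_0(u)\,du-2\nu\sum_{n\ge0}l_n\int_s^tY_n^2(u)\,du$$ (equivalently $\lim_{n\to\infty}\int_s^tk_{n}Y_{n-1}^2(u)Y_{n}(u)\,du=0$);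 otherwise it has anomalous dissipation in $[s,t]$. For a stationary solution these notions do not depend on the interval $[s,t]$, so the interval is omitted. In (iii), $C$ may depend on $\nu,\beta,\gamma$ but not on $f$. *)

(* Defs.v *)
From Stdlib Require Import Reals.
From Coquelicot Require Import Coquelicot.
Open Scope R_scope.

Definition nonneg_reals (t : R) : Prop := 0 <= t.

Definition k (beta : R) (n : nat) : R := Rpower 2 (beta * INR n).
Definition l (gamma : R) (n : nat) : R := Rpower 2 (gamma * INR n).

(* [prev f Y n] is Y_{n-1}, with the boundary convention Y_{-1} = f. *)
Definition prev (f : R) (Y : nat -> R -> R) (n : nat) (t : R) : R :=
  match n with
  | O => f
  | S m => Y m t
  end.

Definition dyadic_rhs (f nu beta gamma : R) (Y : nat -> R -> R)
    (n : nat) (t : R) : R :=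
  - nu * l gamma n * Y n t + k beta n * (prev f Y n t) ^ 2
  - k beta (S n) * Y n t * Y (S n) t.

(* The components are functions on [0, oo), represented as functions on R whose
   values at negative times are irrelevant: derivative and continuity are taken
   relative to [0, oo), hence one-sided at 0. *)
Definition componentwise_solution (f nu beta gamma : R)
    (Y : nat -> R -> R) : Prop :=
  forall n : nat, exists Y' : R -> R,
    (forall t, 0 <= t -> D_in (Y n) Y' nonneg_reals t) /\
    (forall t, 0 <= t -> continue_in Y' nonneg_reals t) /\
    (forall t, 0 <= t -> Y' t = dyadic_rhs f nu beta gamma Y n t).

Definition square_summable (Y : nat -> R -> R) : Prop :=
  forall t, 0 <= t -> ex_series (fun n => (Y n t) ^ 2).

Definition positive (Y : nat -> R -> R) : Prop :=
  forall n t, 0 <= t -> 0 <= Y n t.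

Definition stationary (Y : nat -> R -> R) : Prop :=
  forall n s t, 0 <= s -> 0 <= t -> Y n s = Y n t.

Definition positive_l2_solution (f nu beta gamma : R)
    (Y : nat -> R -> R) : Prop :=
  componentwise_solution f nu beta gamma Y /\ square_summable Y /\ positive Y.

Definition stationary_positive_l2_solution (f nu beta gamma : R)
    (Y : nat -> R -> R) : Prop :=
  positive_l2_solution f nu beta gamma Y /\ stationary Y.

Definition energy (Y : nat -> R -> R) (t : R) : R :=
  Series (fun n => (Y n t) ^ 2).

(* The dissipated energy nu * sum_n l_n int_s^t Y_n^2 has nonnegative terms and
   may be infinite, in which case the balance fails; as [Series] is then a
   dummy value, convergence is required explicitly. The factor nu is kept inside
   the sum, so that the term vanishes for nu = 0 (0 * oo = 0). *)
Definition conservative_on (f nu gamma : R) (Y : nat -> R -> R)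
    (s t : R) : Prop :=
  let dissipation n := nu * (l gamma n * RInt (fun u => (Y n u) ^ 2) s t) in
  ex_series dissipation /\
  energy Y t = energy Y s + 2 * f ^ 2 * RInt (Y 0%nat) s t
               - 2 * Series dissipation.

Definition anomalous_dissipation_on (f nu gamma : R) (Y : nat -> R -> R)
    (s t : R) : Prop :=
  ~ conservative_on f nu gamma Y s t.

Definition conservative (f nu gamma : R) (Y : nat -> R -> R) : Prop :=
  forall s t, 0 <= s -> s < t -> conservative_on f nu gamma Y s t.

(* For stationary solutions the choice of interval is immaterial, so anomalous
   dissipation is asked for on every interval; it is a priori stronger than the
   negation of [conservative]. *)
Definition anomalous_dissipation (f nu gamma : R) (Y : nat -> R -> R) : Prop :=
  forall s t, 0 <= s -> s < t -> anomalous_dissipation_on f nu gamma Y s t.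

Definition regular (Y : nat -> R -> R) : Prop :=
  forall s t, 0 <= t -> ex_series (fun n => (Rpower 2 (s * INR n) * Y n t) ^ 2).

(* Main.v *)
Require Import Defs.
From Stdlib Require Import Reals Lra Lia.
From Coquelicot Require Import Coquelicot.
Open Scope R_scope.

(** With [a = 2^(beta/3)], [th = 2^(gamma - 2 beta/3)], [kap = nu/a] and
    [X (n+1) = a^(n+1) Y_n], [X 0 = f], stationarity becomes
    [X (n+1) (kap th^n + X (n+2)) = X n ^2], and the energy flux is
    [F n = X n ^2 * X (n+1)], with [F n - F (n+1) = kap th^n X (n+1)^2]; the
    solution is conservative iff [F] tends to [0].

    Uniqueness: two solutions with the same [X 0] cross at every index and their
    ratio diverges super-exponentially; as both are at most [M a^n], this forces
    both to decay super-exponentially, which is incompatible with such ratios.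
    Existence for [kap > 0]: shoot in [X 1]; the values for which the first
    nonpositive term has even, resp. odd, index form two disjoint nonempty open
    sets, which cannot cover the line. A positive solution is then automatically
    square summable by the flux balance. For [nu = 0] the constant [X] works.

    If [th >= 1], then [X] tends to [0] by the flux balance, hence super-exponentially
    since [X (n+1) <= X n ^2 / kap]. If [th < 1] and [kap/f] is small, the ratios
    [X (n+1) / X n] must stay in some [[c, 1/c]], as otherwise the
    oscillations would blow up; then [F (n+1) / F n] tends to [1] geometrically
    fast and [F] stays away from [0]. *)

(** * The rescaled stationary recursion and geometric estimates *)

Definition cascade (kap th : R) (X : nat -> R) : Prop :=
  (forall n, 0 < X n) /\
  forall n, X (S n) * (kap * th ^ n + X (S (S n))) = X n ^ 2.

(** The constant absorbs the terms before index [N]; the induction on [N] shifts the sequence by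
    one. *)
Lemma geometric_bound (q : R) (N : nat) (w : nat -> R) :
  0 < q -> (forall n, 0 <= w n) ->
  (forall n, (N <= n)%nat -> w (S n) <= q * w n) ->
  exists C, 0 < C /\ forall n, w n <= C * q ^ n.
Proof.
intros Hq; revert w; induction N as [|N IH]; intros w Hw H.
- exists (w 0%nat + 1); split; [specialize (Hw 0%nat); lra|].
  induction n as [|n IHn]; [simpl; lra|].
  apply Rle_trans with (1 := H n ltac:(lia)); simpl.
  apply Rle_trans with (q * ((w 0%nat + 1) * q ^ n)); [nra | lra].
- destruct (IH (fun n => w (S n))) as [C [HC HCn]].
  + intros n; apply Hw.
  + intros n Hn; apply (H (S n)); lia.
  + assert (HCq : 0 < C / q) by (apply Rdiv_lt_0_compat; assumption).
    exists (w 0%nat + C / q); split; [specialize (Hw 0%nat); lra|].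
    intros [|n]; [simpl; specialize (Hw 0%nat); nra|].
    apply Rle_trans with (1 := HCn n).
    replace ((w 0%nat + C / q) * q ^ S n)
      with (w 0%nat * q ^ S n + C * q ^ n) by (simpl; field; lra).
    assert (0 <= w 0%nat * q ^ S n); [|lra].
    apply Rmult_le_pos; [apply Hw | apply pow_le; lra].
Qed.

Lemma pow_eventually_lt (q C e : R) :
  0 < q < 1 -> 0 < C -> 0 < e ->
  exists N, forall n, (N <= n)%nat -> C * q ^ n < e.
Proof.
intros Hq HC He.
destruct (pow_lt_1_zero q) with (y := e / C) as [N HN].
- rewrite Rabs_pos_eq; lra.
- apply Rdiv_lt_0_compat; assumption.
- exists N; intros n Hn; specialize (HN n Hn).
  rewrite Rabs_pos_eq in HN by (apply pow_le; lra).
  apply Rmult_lt_compat_l with (1 := HC) in HN.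
  replace (C * (e / C)) with e in HN by (field; lra); exact HN.
Qed.

(** * Uniqueness of cascades with exponential growth bounds *)

(** A bootstrap in two rounds: the bound [w (S n) <= h < 1] gives geometric decay at rate [h]; hence
    [w n ^ 2] is eventually below any [e], and it is this factor that bounds the ratio of
    consecutive terms. *)
Lemma superexponential_decay (w : nat -> R) :
  (forall n, 0 < w n <= 1) -> w 1%nat < 1 ->
  (forall n, w (S (S n)) <= w (S n) * w n ^ 2) ->
  forall e, 0 < e -> exists C, 0 < C /\ forall n, w n <= C * e ^ n.
Proof.
intros Hw H1 Hrec e He.
set (h := w 1%nat).
assert (Hh : 0 < h < 1) by (split; [apply Hw | exact H1]).
assert (Hwh : forall n, w (S n) <= h).
{ induction n as [|n IH]; [apply Rle_refl|].
  assert (A := Hw n); assert (B := Hw (S n)); assert (D := Hrec n).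
  assert (w n ^ 2 <= 1) by nra. nra. }
destruct (geometric_bound h 2 w) as [C [HC HCn]]; [lra | intros n; apply Rlt_le, Hw | |].
{ intros [|[|n]] Hn; try lia.
  assert (A := Hw (S n)); assert (B := Hw (S (S n))).
  assert (D := Hrec (S n)); assert (E := Hwh n).
  assert (w (S n) ^ 2 <= h) by nra. nra. }
destruct (pow_eventually_lt h C (Rmin 1 e)) as [N HN]; try assumption.
{ apply Rmin_glb_lt; lra. }
apply (geometric_bound e (S N)); [assumption | intros n; apply Rlt_le, Hw |].
intros [|n] Hn; [lia|].
apply Rle_trans with (1 := Hrec n).
assert (A := Hw n); assert (B := Hw (S n)).
assert (D := HCn n); assert (E := HN n ltac:(lia)).
assert (E1 := Rmin_l 1 e); assert (E2 := Rmin_r 1 e).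
assert (w n ^ 2 <= e) by nra. nra.
Qed.

(* Two solutions with the same [X 0] cross at each index; [u] collects the
   smaller and [v] the larger values. *)
Lemma interleaved_cascades_absurd (kap th a M : R) (u v : nat -> R) :
  0 <= kap -> 0 < th -> 0 < a -> 0 < M ->
  (forall n, 0 < u n) -> (forall n, 0 < v n) ->
  (forall n, u (S n) * (kap * th ^ n + v (S (S n))) = v n ^ 2) ->
  (forall n, v (S n) * (kap * th ^ n + u (S (S n))) = u n ^ 2) ->
  u 0%nat = v 0%nat -> u 1%nat < v 1%nat ->
  (forall n, v n <= M * a ^ n) -> False.
Proof.
intros Hk Hth Ha HM Hu Hv Eu Ev H0 H1 Hb.
set (w := fun n => u n / v n).
assert (Hw0 : forall n, 0 < w n) by (intro; apply Rdiv_lt_0_compat; auto).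
assert (HK : forall n, 0 <= kap * th ^ n).
{ intros n; apply Rmult_le_pos; [lra | apply pow_le; lra]. }
(* Quotient of the two recursions. *)
assert (Hww : forall n, w (S n) * w n ^ 2 =
   (kap * th ^ n + u (S (S n))) / (kap * th ^ n + v (S (S n)))).
{ intros n; unfold w.
  assert (A := Hu (S n)); assert (B := Hv (S n)).
  assert (A' := Hv n); assert (B' := Hv (S (S n))); assert (D := HK n).
  replace ((u n / v n) ^ 2) with (u n ^ 2 / v n ^ 2) by (field; lra).
  rewrite <- Eu, <- Ev; field; repeat split; lra. }
assert (Hle : forall n, w n <= 1 /\ w (S n) <= 1).
{ induction n as [|n [IH1 IH2]].
  - unfold w; split; apply Rle_div_l; try apply Hv; lra.
  - split; [assumption|].
    assert (A := Hww n); assert (B := Hw0 n); assert (D := Hw0 (S n)).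
    assert (w (S n) * w n ^ 2 <= 1) by (assert (w n ^ 2 <= 1) by nra; nra).
    rewrite A in H; apply Rle_div_l in H;
      [|assert (F := HK n); specialize (Hv (S (S n))); lra].
    unfold w; apply Rle_div_l; [apply Hv | lra]. }
(* Adding the same nonnegative [kap * th ^ n] to the smaller and to the larger value moves their
   ratio towards 1. *)
assert (Hrec : forall n, w (S (S n)) <= w (S n) * w n ^ 2).
{ intros n; rewrite Hww; unfold w.
  assert (A := HK n); assert (B := Hv (S (S n))).
  assert (D := proj2 (Hle (S n))); unfold w in D; apply Rle_div_l in D; [|apply B].
  apply Rle_div_l; [apply B|].
  replace ((kap * th ^ n + u (S (S n))) / (kap * th ^ n + v (S (S n))) * v (S (S n)))
    with ((kap * th ^ n + u (S (S n))) * v (S (S n)) / (kap * th ^ n + v (S (S n))))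
    by (field; lra).
  apply Rle_div_r; [lra|]. nra. }
assert (Hdec := superexponential_decay w
  (fun n => conj (Hw0 n) (proj1 (Hle n)))).
lapply Hdec; clear Hdec; [intros Hdec | apply (Rlt_div_l _ _ _ (Hv 1%nat)); lra].
specialize (Hdec Hrec).
assert (Huw : forall n, u n = w n * v n).
{ intros n; unfold w; field; specialize (Hv n); lra. }
(* The recursion reads [v n ^ 2 = w (S n) * v (S n) * (kap * th ^ n + v (S (S n)))]: the last two
   factors grow at most exponentially, so the decay of [w] passes to [v]. *)
assert (Hsmall : forall r, 0 < r -> exists C, 0 < C /\ forall n, v n ^ 2 <= C * r ^ n).
{ intros r Hr.
  (* [D] dominates both bases [th] and [a]. Each of the two growing factors costs [D ^ n], so [w]
     has to decay at rate [r / D ^ 2]. *)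
  set (D := 1 + th + a).
  assert (HD : 1 <= D) by (unfold D; lra).
  assert (HMa : 0 < M * a) by (apply Rmult_lt_0_compat; assumption).
  assert (HMa2 : 0 < M * a ^ 2) by (apply Rmult_lt_0_compat; nra).
  assert (HD2 : 0 < D ^ 2) by (apply pow_lt; lra).
  destruct (Hdec (r / D ^ 2)) as [C [HC HCn]].
  { apply Rdiv_lt_0_compat; [assumption | exact HD2]. }
  set (e := r / D ^ 2) in *.
  assert (He : 0 < e) by (apply Rdiv_lt_0_compat; [assumption | exact HD2]).
  exists (C * e * (M * a) * (kap + M * a ^ 2)); split.
  { apply Rmult_lt_0_compat; [|lra].
    apply Rmult_lt_0_compat; [|assumption]; apply Rmult_lt_0_compat; assumption. }
  intros n; rewrite <- Eu, Huw.
  assert (A : v (S n) <= M * a * D ^ n).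
  { apply Rle_trans with (1 := Hb (S n)); simpl; rewrite <- Rmult_assoc.
    apply Rmult_le_compat_l; [lra | apply pow_incr; unfold D; lra]. }
  assert (B : kap * th ^ n + v (S (S n)) <= (kap + M * a ^ 2) * D ^ n).
  { assert (th ^ n <= D ^ n) by (apply pow_incr; unfold D; lra).
    assert (a ^ n <= D ^ n) by (apply pow_incr; unfold D; lra).
    assert (Z := Hb (S (S n))); simpl in Z.
    assert (M * (a * (a * a ^ n)) <= M * a ^ 2 * D ^ n).
    { replace (M * (a * (a * a ^ n))) with (M * a ^ 2 * a ^ n) by ring.
      apply Rmult_le_compat_l; lra. }
    nra. }
  replace (C * e * (M * a) * (kap + M * a ^ 2) * r ^ n)
    with (C * e ^ S n * (M * a * D ^ n) * ((kap + M * a ^ 2) * D ^ n)).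
  2:{ replace r with (e * (D * D)) by (unfold e; field; lra).
      rewrite !Rpow_mult_distr; simpl; ring. }
  assert (P1 := Hw0 (S n)); assert (P2 := Hv (S n)); assert (P3 := HK n).
  assert (P4 := Hv (S (S n))).
  apply Rmult_le_compat; [nra | lra | | assumption].
  apply Rmult_le_compat; [lra | lra | apply HCn | assumption]. }
destruct (Rle_lt_or_eq_dec 0 kap Hk) as [Hk'|Hk'].
(* This rate makes [v (S (S n))] eventually smaller than [kap * th ^ n]. The right side of [Hww]
   then exceeds 1/2, whereas its left side tends to 0. *)
- destruct (Hsmall (th ^ 2 / 2)) as [C [HC HCn]]; [nra|].
  destruct (pow_eventually_lt (1 / 2) (C * th ^ 4) (kap ^ 2)) as [N1 HN1];
    [lra | assert (0 < th ^ 4) by (apply pow_lt; lra); nra | nra |].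
  destruct (Hdec (1 / 2)) as [C2 [HC2 HC2n]]; [lra|].
  destruct (pow_eventually_lt (1 / 2) C2 (1 / 2)) as [N2 HN2]; [lra..|].
  set (n := (N1 + N2)%nat).
  assert (Hvk : v (S (S n)) <= kap * th ^ n).
  { apply Rsqr_incr_0_var; [|apply HK].
    unfold Rsqr; specialize (HCn (S (S n))); specialize (HN1 n ltac:(lia)).
    replace (C * (th ^ 2 / 2) ^ S (S n)) with
      (C * th ^ 4 * (1 / 2) ^ n * (th ^ n) ^ 2 / 4) in HCn.
    2:{ replace (th ^ 2 / 2) with (th * th * (1 / 2)) by field.
        rewrite !Rpow_mult_distr; simpl; field. }
    assert (T : 0 < (th ^ n) ^ 2) by (apply pow_lt, pow_lt; lra).
    nra. }
  assert (A := Hww n).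
  assert (P := HC2n (S n)); assert (Q := HN2 (S n) ltac:(lia)).
  assert (B := Hw0 (S n)); assert (D := Hle n); assert (D' := Hw0 n).
  assert (E : w (S n) * w n ^ 2 < 1 / 2) by (assert (w n ^ 2 <= 1) by nra; nra).
  assert (Z : 0 < kap * th ^ n) by (apply Rmult_lt_0_compat; [lra | apply pow_lt; lra]).
  assert (Z1 := Hv (S (S n))); assert (Z2 := Hu (S (S n))).
  assert (Z3 : kap * th ^ n + v (S (S n)) > 0) by lra.
  rewrite A in E; apply (Rlt_div_l _ _ _ Z3) in E; lra.
- subst kap.
  (* Without viscosity this mixed flux is conserved and positive, yet the decay of [v] forces it to
     0. *)
  assert (Hflux : forall n, v n ^ 2 * u (S n) + u n ^ 2 * v (S n)
                  = v 0%nat ^ 2 * u 1%nat + u 0%nat ^ 2 * v 1%nat).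
  { induction n as [|n IH]; [reflexivity|].
    rewrite <- IH, <- (Eu n), <- (Ev n); ring. }
  set (c := v 0%nat ^ 2 * u 1%nat + u 0%nat ^ 2 * v 1%nat) in *.
  assert (Hc : 0 < c).
  { apply Rplus_lt_0_compat; apply Rmult_lt_0_compat; auto using pow_lt. }
  destruct (Hsmall (1 / 2)) as [C [HC HCn]]; [lra|].
  destruct (pow_eventually_lt (1 / 2) C (Rmin 1 (c / 2))) as [N HN];
    [lra | lra | apply Rmin_glb_lt; lra |].
  assert (A := HCn N); assert (B := HN N ltac:(lia)).
  assert (A' := HCn (S N)); assert (B' := HN (S N) ltac:(lia)).
  assert (E1 := Rmin_l 1 (c / 2)); assert (E2 := Rmin_r 1 (c / 2)).
  specialize (Hflux N).
  assert (Q : v (S N) < 1) by (specialize (Hv (S N)); nra).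
  assert (Q1 : u (S N) <= v (S N)).
  { rewrite Huw; assert (G := Hle N); specialize (Hv (S N)); nra. }
  assert (Q2 : u N <= v N).
  { rewrite Huw; assert (G := Hle N); specialize (Hv N); nra. }
  assert (Q3 : u N ^ 2 <= v N ^ 2) by (apply pow_incr; specialize (Hu N); lra).
  assert (R1 := Hu (S N)); assert (R2 := Hu N).
  assert (v N ^ 2 * u (S N) <= v N ^ 2 * 1) by (apply Rmult_le_compat_l; nra).
  assert (u N ^ 2 * v (S N) <= v N ^ 2 * 1) by (apply Rmult_le_compat; nra).
  lra.
Qed.

(** Alternating between [Z] and [X] by parity gives the ordered pair of the previous lemma; each of
    its relations at index [n] is the recursion of one of the two cascades. *)
Lemma cascade_second_unique (kap th a M : R) (X Z : nat -> R) :
  0 <= kap -> 0 < th -> 0 < a -> 0 < M ->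
  cascade kap th X -> cascade kap th Z -> X 0%nat = Z 0%nat ->
  (forall n, X n <= M * a ^ n) -> (forall n, Z n <= M * a ^ n) ->
  ~ X 1%nat < Z 1%nat.
Proof.
intros Hk Hth Ha HM [HX EX] [HZ EZ] H0 BX BZ H1.
apply (interleaved_cascades_absurd kap th a M
  (fun n => if Nat.even n then Z n else X n)
  (fun n => if Nat.even n then X n else Z n)); auto.
- intros n; destruct (Nat.even n); auto.
- intros n; destruct (Nat.even n); auto.
- intros n; rewrite Nat.even_succ_succ, Nat.even_succ, <- Nat.negb_even.
  destruct (Nat.even n); simpl negb; cbv iota; auto.
- intros n; rewrite Nat.even_succ_succ, Nat.even_succ, <- Nat.negb_even.
  destruct (Nat.even n); simpl negb; cbv iota; auto.
- intros n; destruct (Nat.even n); auto.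
Qed.

Lemma cascade_unique (kap th a M M' : R) (X Z : nat -> R) :
  0 <= kap -> 0 < th -> 0 < a ->
  cascade kap th X -> cascade kap th Z -> X 0%nat = Z 0%nat ->
  (forall n, X n <= M * a ^ n) -> (forall n, Z n <= M' * a ^ n) ->
  forall n, X n = Z n.
Proof.
intros Hk Hth Ha HX HZ H0 BX BZ.
set (B := 1 + Rabs M + Rabs M').
assert (HB : M <= B /\ M' <= B /\ 0 < B).
{ unfold B; assert (A := Rle_abs M); assert (A' := Rle_abs M').
  assert (D := Rabs_pos M); assert (D' := Rabs_pos M'); lra. }
assert (BX' : forall n, X n <= B * a ^ n).
{ intros n; apply Rle_trans with (1 := BX n).
  apply Rmult_le_compat_r; [apply pow_le|]; lra. }
assert (BZ' : forall n, Z n <= B * a ^ n).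
{ intros n; apply Rle_trans with (1 := BZ n).
  apply Rmult_le_compat_r; [apply pow_le|]; lra. }
assert (H1 : X 1%nat = Z 1%nat).
{ apply Rle_antisym; apply Rnot_lt_le;
    apply cascade_second_unique with kap th a B; auto; apply HB. }
assert (H : forall n, X n = Z n /\ X (S n) = Z (S n)); [|intros n; apply H].
destruct HX as [PX EX], HZ as [PZ EZ].
induction n as [|n [IH1 IH2]]; [auto|split; [assumption|]].
assert (A := EX n); rewrite IH1, <- EZ, IH2 in A.
apply Rmult_eq_reg_l in A; [lra | specialize (PZ (S n)); lra].
Qed.

(** * Existence for positive viscosity by shooting *)

(** The recursion of [cascade] solved for its last term, with [s] as the value at index 1. Terms
    beyond the first nonpositive one may come from a division by zero; [first_failure] never looks
    at them. *)
Fixpoint orbit (kap th f s : R) (n : nat) : R :=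
  match n with
  | O => f
  | S m => match m with
           | O => s
           | S p => orbit kap th f s p ^ 2 / orbit kap th f s m - kap * th ^ p
           end
  end.

Definition first_failure (kap th f s : R) (n : nat) : Prop :=
  (forall j, (j < n)%nat -> 0 < orbit kap th f s j) /\ orbit kap th f s n <= 0.

Definition fails_with_parity (kap th f : R) (b : bool) (s : R) : Prop :=
  exists n, Nat.even n = b /\ first_failure kap th f s n.

Lemma orbit_continuous (kap th f s : R) (n : nat) :
  (forall j, (j < n)%nat -> 0 < orbit kap th f s j) ->
  continuity_pt (fun s => orbit kap th f s n) s.
Proof.
induction n as [n IH] using (well_founded_induction Wf_nat.lt_wf); intros H.
destruct n as [|[|p]].
- apply continuity_pt_const; intros x y; reflexivity.
- apply derivable_continuous_pt, derivable_pt_id.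
- assert (Cp := IH p ltac:(lia) (fun j Hj => H j ltac:(lia))).
  assert (CSp := IH (S p) ltac:(lia) (fun j Hj => H j ltac:(lia))).
  set (g := orbit kap th f) in *.
  change (continuity_pt (minus_fct (div_fct (fun s => g s p ^ 2) (fun s => g s (S p)))
            (fun _ => kap * th ^ p)) s).
  apply continuity_pt_minus; [apply continuity_pt_div|]; auto.
  + apply (continuity_pt_comp (fun s => g s p) (fun x => x ^ 2)); auto.
    apply derivable_continuous_pt, derivable_pt_pow.
  + apply Rgt_not_eq, (H (S p)); lia.
  + apply continuity_pt_const; intros x y; reflexivity.
Qed.

Lemma locally_forall_lt (s : R) (P : nat -> R -> Prop) (n : nat) :
  (forall j, (j < n)%nat -> locally s (P j)) ->
  locally s (fun x => forall j, (j < n)%nat -> P j x).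
Proof.
induction n as [|n IH]; intros H.
- apply filter_forall; intros; lia.
- generalize (filter_and (F := locally s) _ _ (H n ltac:(lia)) (IH (fun j Hj => H j ltac:(lia)))).
  apply filter_imp; intros x [H1 H2] j Hj.
  destruct (Nat.eq_dec j n) as [->|]; [assumption | apply H2; lia].
Qed.

Lemma locally_gt (g : R -> R) (s c : R) :
  continuity_pt g s -> c < g s -> locally s (fun x => c < g x).
Proof.
intros Hg H; apply continuity_pt_filterlim in Hg.
apply (Hg (fun y => c < y)), open_gt, H.
Qed.

Lemma locally_lt (g : R -> R) (s c : R) :
  continuity_pt g s -> g s < c -> locally s (fun x => g x < c).
Proof.
intros Hg H; apply continuity_pt_filterlim in Hg.
apply (Hg (fun y => y < c)), open_lt, H.
Qed.

(* If [X n] vanishes at [s] and becomes positive nearby, then [X (n + 1)] is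
   huge there, so that [X (n + 2)] is negative: the parity is preserved. *)
Lemma fails_with_parity_open (kap th f s : R) (b : bool) :
  0 < kap -> 0 < th -> 0 < f ->
  fails_with_parity kap th f b s ->
  locally s (fails_with_parity kap th f b).
Proof.
intros Hk Hth Hf [[|p] [Hb [Hpos Hfail]]]; [simpl in Hfail; lra|].
set (g := orbit kap th f) in *.
assert (HK : forall n, 0 < kap * th ^ n).
{ intros n; apply Rmult_lt_0_compat; [|apply pow_lt]; assumption. }
set (c := g s p / 2).
assert (Hgp : 0 < g s p) by (apply Hpos; lia).
assert (Hc : 0 < c) by (unfold c; lra).
(* If the term at [S p] lies in [(0, e)], the first bound makes the next term at least 1; the other
   two give [e ^ 2 <= kap * th ^ S p], so the term after that is nonpositive. *)
set (e := Rmin (c ^ 2 / (kap * th ^ p + 1)) (Rmin 1 (kap * th ^ S p))).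
assert (He1 : e * (kap * th ^ p + 1) <= c ^ 2).
{ apply Rle_div_r; [specialize (HK p); lra | apply Rmin_l]. }
assert (He2 : e <= 1) by (eapply Rle_trans; [apply Rmin_r | apply Rmin_l]).
assert (He3 : e <= kap * th ^ S p) by (eapply Rle_trans; [apply Rmin_r | apply Rmin_r]).
assert (He : 0 < e).
{ apply Rmin_glb_lt; [|apply Rmin_glb_lt; [lra | apply HK]].
  apply Rdiv_lt_0_compat; [apply pow_lt | specialize (HK p)]; lra. }
assert (L1 : locally s (fun x => forall j, (j < S p)%nat -> 0 < g x j)).
{ apply locally_forall_lt; intros j Hj.
  apply locally_gt; [|apply Hpos; assumption].
  apply orbit_continuous; intros i Hi; apply Hpos; lia. }
assert (L2 : locally s (fun x => c < g x p)).
{ apply (locally_gt (fun x => g x p)); [|unfold c; lra].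
  apply orbit_continuous; intros i Hi; apply Hpos; lia. }
assert (L3 : locally s (fun x => g x (S p) < e)).
{ apply (locally_lt (fun x => g x (S p))); [|lra].
  apply orbit_continuous; exact Hpos. }
generalize (filter_and _ _ L1 (filter_and _ _ L2 L3)).
apply filter_imp; clear L1 L2 L3; intros x [P1 [P2 P3]].
destruct (Rle_lt_dec (g x (S p)) 0) as [Hle|Hlt].
- exists (S p); repeat split; assumption.
- assert (E1 : g x (S (S p)) = g x p ^ 2 / g x (S p) - kap * th ^ p) by reflexivity.
  assert (E2 : g x (S (S (S p))) = g x (S p) ^ 2 / g x (S (S p)) - kap * th ^ S p)
    by reflexivity.
  assert (Q : kap * th ^ p + 1 <= g x p ^ 2 / g x (S p)).
  { apply Rle_div_r; [assumption|]. specialize (HK p). nra. }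
  exists (S (S (S p))); split; [rewrite <- Hb; reflexivity | split].
  + intros j Hj.
    destruct (Nat.eq_dec j (S (S p))) as [->|]; [fold g; lra|].
    destruct (Nat.eq_dec j (S p)) as [->|]; [assumption | apply P1; lia].
  + fold g; rewrite E2; apply Rle_minus, Rle_div_l; [lra|].
    specialize (HK (S p)); nra.
Qed.

Lemma first_failure_unique (kap th f s : R) (n m : nat) :
  first_failure kap th f s n -> first_failure kap th f s m -> n = m.
Proof.
intros [H1 H2] [H3 H4].
destruct (Nat.lt_trichotomy n m) as [H|[H|H]]; [|assumption|].
- specialize (H3 n H); lra.
- specialize (H1 m H); lra.
Qed.

(** Connectedness of the line is used through the supremum of [bad false]: it belongs to neither of
    the two disjoint open sets, so its orbit never fails. *)
Lemma cascade_exists_viscous (kap th f : R) :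
  0 < kap -> 0 < th -> 0 < f -> exists X, cascade kap th X /\ X 0%nat = f.
Proof.
intros Hk Hth Hf.
set (bad := fails_with_parity kap th f).
assert (Hdisj : forall s, bad true s -> bad false s -> False).
{ intros s [n [Hn Fn]] [m [Hm Fm]].
  rewrite (first_failure_unique _ _ _ _ _ _ Fn Fm) in Hn; congruence. }
assert (Hlarge : forall s, f ^ 2 / kap <= s -> bad true s).
{ intros s Hs; exists 2%nat; split; [reflexivity|].
  assert (0 < s).
  { apply Rlt_le_trans with (2 := Hs); apply Rdiv_lt_0_compat; [apply pow_lt|]; lra. }
  split.
  - intros [|[|j]] Hj; simpl; [assumption | assumption | lia].
  - simpl; apply Rle_minus, Rle_div_l; [assumption|].
    apply Rle_div_l in Hs; simpl in *; lra. }
destruct (completeness (bad false)) as [s [Hub Hlub]].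
{ exists (f ^ 2 / kap); intros x Hx; apply Rnot_lt_le; intros H.
  apply (Hdisj x); [apply Hlarge; lra | assumption]. }
(* The value [s = 0] is itself nonpositive, so the failure occurs at the odd index 1. *)
{ exists 0, 1%nat; split; [reflexivity | split; [|apply Rle_refl]].
  intros j Hj; replace j with 0%nat by lia; exact Hf. }
(* A neighbourhood inside [bad true] would allow a smaller upper bound; one inside [bad false] would
   contain points above the supremum. *)
assert (Hnot : forall b, ~ bad b s).
{ intros b Hbad.
  destruct (fails_with_parity_open _ _ _ _ _ Hk Hth Hf Hbad) as [d Hd].
  assert (Hd0 := cond_pos d).
  assert (Hball : forall x, Rabs (x - s) < d -> bad b x) by (intros x Hx; apply Hd, Hx).
  destruct b.
  - assert (s <= s - d / 2); [|lra].
    apply Hlub; intros x Hx; apply Rnot_lt_le; intros H.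
    apply (Hdisj x); [apply Hball | assumption].
    specialize (Hub x Hx); apply Rabs_def1; lra.
  - assert (s + d / 2 <= s); [|lra].
    apply Hub, Hball; replace (s + d / 2 - s) with (d / 2) by ring.
    rewrite Rabs_pos_eq; lra. }
assert (Hpos : forall n, 0 < orbit kap th f s n).
{ induction n as [n IH] using (well_founded_induction Wf_nat.lt_wf).
  apply Rnot_le_lt; intros H; apply (Hnot (Nat.even n)).
  exists n; repeat split; assumption. }
exists (orbit kap th f s); split; [split; [assumption|] | reflexivity].
intros n; assert (A := Hpos (S n)); set (g := orbit kap th f s) in *.
change (g (S (S n))) with (g n ^ 2 / g (S n) - kap * th ^ n); field; lra.
Qed.

(** * Energy flux and its balance *)

(** For a rescaled solution this is [scale_base beta] times the physical flux
    [k_n Y_{n-1}^2 Y_n]. *)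
Definition flux (X : nat -> R) (n : nat) : R := X n ^ 2 * X (S n).

Lemma flux_pos (kap th : R) (X : nat -> R) (n : nat) :
  cascade kap th X -> 0 < flux X n.
Proof.
intros [HX _]; apply Rmult_lt_0_compat; [apply pow_lt|]; apply HX.
Qed.

Lemma flux_balance (kap th : R) (X : nat -> R) (n : nat) :
  cascade kap th X -> flux X n - flux X (S n) = kap * th ^ n * X (S n) ^ 2.
Proof. intros [_ EX]; unfold flux; rewrite <- EX; ring. Qed.

Lemma flux_decr (kap th : R) (X : nat -> R) (n : nat) :
  0 <= kap -> 0 < th -> cascade kap th X -> flux X (S n) <= flux X n.
Proof.
intros Hk Hth HX; assert (A := flux_balance _ _ _ n HX).
assert (0 <= kap * th ^ n * X (S n) ^ 2); [|lra].
apply Rmult_le_pos; [apply Rmult_le_pos; [|apply pow_le; lra] | apply pow2_ge_0]; assumption.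
Qed.

Lemma sum_n_telescope (F : nat -> R) (n : nat) :
  sum_n (fun n => F n - F (S n)) n = F 0%nat - F (S n).
Proof.
induction n as [|n IH]; [apply sum_O|].
rewrite sum_Sn, IH; unfold plus; simpl; ring.
Qed.

Lemma is_series_telescope (F : nat -> R) (z : R) :
  is_lim_seq F z -> is_series (fun n => F n - F (S n)) (F 0%nat - z).
Proof.
intros H; change (is_lim_seq (sum_n (fun n => F n - F (S n))) (F 0%nat - z)).
apply is_lim_seq_ext with (fun n => F 0%nat - F (S n)).
- intros n; symmetry; apply sum_n_telescope.
- apply (is_lim_seq_minus' _ _ _ _ (is_lim_seq_const _)).
  apply (is_lim_seq_incr_1 F), H.
Qed.

Lemma telescope_limit (F : nat -> R) (z : R) :
  is_series (fun n => F n - F (S n)) z -> is_lim_seq F (F 0%nat - z).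
Proof.
intros H; change (is_lim_seq (sum_n (fun n => F n - F (S n))) z) in H.
apply is_lim_seq_incr_1, is_lim_seq_ext
  with (fun n => F 0%nat - sum_n (fun n => F n - F (S n)) n).
- intros n; rewrite sum_n_telescope; ring.
- apply (is_lim_seq_minus' _ _ _ _ (is_lim_seq_const _) H).
Qed.

Lemma flux_cvg (kap th : R) (X : nat -> R) :
  0 <= kap -> 0 < th -> cascade kap th X -> exists z : R, is_lim_seq (flux X) z.
Proof.
intros Hk Hth HX; apply (ex_finite_lim_seq_decr _ 0).
- intros n; apply (flux_decr kap th); assumption.
- intros n; apply Rlt_le, (flux_pos kap th), HX.
Qed.

Lemma cascade_dissipation_summable (kap th : R) (X : nat -> R) :
  0 <= kap -> 0 < th -> cascade kap th X ->
  ex_series (fun n => kap * th ^ n * X (S n) ^ 2).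
Proof.
intros Hk Hth HX; destruct (flux_cvg _ _ _ Hk Hth HX) as [z Hz].
exists (flux X 0%nat - z); apply is_series_ext with (2 := is_series_telescope _ _ Hz).
intros n; apply flux_balance, HX.
Qed.

Lemma flux_to_zero (X : nat -> R) : is_lim_seq X 0 -> is_lim_seq (flux X) 0.
Proof.
intros H; assert (H1 := H); apply is_lim_seq_incr_1 in H1.
replace 0 with (0 * 0 * 0) by ring.
apply is_lim_seq_ext with (fun n => X n * X n * X (S n)).
- intros n; unfold flux; ring.
- apply is_lim_seq_mult'; [apply is_lim_seq_mult'|]; assumption.
Qed.

(** * Super-exponential decay for [th >= 1] *)

Lemma cascade_superexponential (kap th : R) (X : nat -> R) :
  0 < kap -> 1 <= th -> cascade kap th X ->
  forall e, 0 < e -> exists C, 0 < C /\ forall n, X n <= C * e ^ n.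
Proof.
intros Hk Hth HX e He.
assert (Hth1 : forall n, 1 <= th ^ n) by (intros n; apply pow_R1_Rle; assumption).
assert (H := ex_series_lim_0 _ (cascade_dissipation_summable kap th X
               ltac:(lra) ltac:(lra) HX)).
apply is_lim_seq_spec in H.
(* Once the dissipation is below this threshold, [X (S n) <= kap * e], and the recursion gives [X (S
   (S n)) <= X (S n) ^ 2 / kap <= e * X (S n)]. *)
assert (Hd : 0 < kap * (kap * e) ^ 2) by (apply Rmult_lt_0_compat; [|apply pow_lt; nra]; lra).
destruct (H (mkposreal _ Hd)) as [N HN]; simpl in HN.
destruct HX as [HX EX].
apply (geometric_bound e (S N)); [assumption | intros n; apply Rlt_le, HX |].
intros [|n] Hn; [lia|].
assert (A := HN n ltac:(lia)); assert (T := Hth1 n); assert (T' := Hth1 (S n)).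
assert (P := HX (S n)); assert (P' := HX (S (S n))); assert (P'' := HX (S (S (S n)))).
assert (Q := EX (S n)).
rewrite Rminus_0_r, Rabs_pos_eq in A.
2:{ apply Rmult_le_pos; [nra | apply Rmult_le_pos; lra]. }
assert (Hke : 0 < kap * e) by nra.
assert (S1 : X (S n) <= kap * e).
{ apply Rnot_lt_le; intros Z.
  assert ((kap * e) * (kap * e) <= X (S n) * X (S n)) by (apply Rmult_le_compat; lra).
  assert (kap * (X (S n) * X (S n)) <= kap * th ^ n * (X (S n) * X (S n))).
  { apply Rmult_le_compat_r; nra. }
  assert (kap * ((kap * e) * (kap * e)) <= kap * (X (S n) * X (S n)))
    by (apply Rmult_le_compat_l; lra).
  rewrite !Rmult_1_r in A; lra. }
apply Rmult_le_reg_l with kap; [assumption|].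
assert (X (S (S n)) * kap <= X (S (S n)) * (kap * th ^ S n + X (S (S (S n))))).
{ apply Rmult_le_compat_l; nra. }
assert (X (S n) ^ 2 <= X (S n) * (kap * e)) by nra.
lra.
Qed.

(** * Lower bound on the flux for [th < 1] *)

(** Here [x, y, z, w] are four consecutive terms and [K] is the viscous coefficient. Two indices
    later the ratio of neighbours has shrunk by a further factor [c], since [w * z <= y ^ 2] and
    [c * x ^ 2 <= z * y], and viscosity is still small, since [x <= z]. *)
Lemma oscillation_step (c K x y z w th : R) :
  0 < c < 1 -> 0 < th <= 1 -> 0 <= K -> 0 < x -> 0 < y -> 0 < z -> 0 < w ->
  y * (K + z) = x ^ 2 -> z * (th * K + w) = y ^ 2 ->
  K <= (1 - c) * x -> y <= c * x ->
  c * x ^ 2 <= z * y /\ w * x <= c * y * z /\ th * (th * K) <= (1 - c) * z.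
Proof.
intros Hc Hth HK Hx Hy Hz Hw E1 E2 H1 H2.
assert (A : c * x ^ 2 <= z * y).
{ assert (K * y <= (1 - c) * x * (c * x)) by (apply Rmult_le_compat; lra).
  assert ((1 - c) * x * (c * x) <= (1 - c) * x ^ 2) by nra. nra. }
assert (B : x <= z).
{ apply Rmult_le_reg_r with (c * x); [nra|].
  apply Rle_trans with (z * y); [nra|]. apply Rmult_le_compat_l; lra. }
split; [assumption | split].
- assert (W : w * z <= y ^ 2).
  { assert (0 <= z * (th * K)) by (repeat apply Rmult_le_pos; lra). lra. }
  apply Rmult_le_reg_r with (z * y ^ 2); [apply Rmult_lt_0_compat; nra|].
  assert (Y3 : y ^ 2 * y <= (c * x) ^ 2 * (c * x)).
  { apply Rmult_le_compat; try nra. }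
  apply Rle_trans with (c * y * (c ^ 2 * x ^ 4)).
  + replace (w * x * (z * y ^ 2)) with (w * z * (x * y ^ 2)) by ring.
    apply Rle_trans with (y ^ 2 * (x * y ^ 2)).
    * apply Rmult_le_compat_r; nra.
    * replace (y ^ 2 * (x * y ^ 2)) with (x * y * (y ^ 2 * y)) by ring.
      replace (c * y * (c ^ 2 * x ^ 4)) with (x * y * ((c * x) ^ 2 * (c * x))) by ring.
      apply Rmult_le_compat_l; [apply Rmult_le_pos; lra | assumption].
  + replace (c * y * z * (z * y ^ 2)) with (c * y * ((z * y) * (z * y))) by ring.
    replace (c ^ 2 * x ^ 4) with ((c * x ^ 2) * (c * x ^ 2)) by ring.
    assert (0 <= c * x ^ 2) by (apply Rmult_le_pos; nra).
    apply Rmult_le_compat_l; [apply Rmult_le_pos; lra|].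
    apply Rmult_le_compat; lra.
- assert (T : 0 <= th * K <= K) by (split; [apply Rmult_le_pos; lra | nra]).
  apply Rle_trans with (th * K); [nra|].
  apply Rle_trans with ((1 - c) * x); [lra | apply Rmult_le_compat_l; lra].
Qed.

(** Iterating [oscillation_step] along [N k = n + 2 * k] makes the neighbour ratio at most
    [c ^ S k], so the terms [X (N k)] grow super-exponentially, against the bound [M * a ^ j]. *)
Lemma oscillation_blowup (kap th c a M : R) (X : nat -> R) (n : nat) :
  0 <= kap -> 0 < th <= 1 -> 0 < c < 1 -> 0 < a -> cascade kap th X ->
  (forall j, X j <= M * a ^ j) ->
  kap * th ^ n <= (1 - c) * X n -> ~ X (S n) <= c * X n.
Proof.
intros Hk Hth Hc Ha [HX EX] HB H1 H2.
set (N := fix N (k : nat) := match k with O => n | S k => S (S (N k)) end).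
assert (HN : forall k, N k = (n + 2 * k)%nat).
{ induction k as [|k IH]; simpl; [lia | rewrite IH; lia]. }
assert (HK : forall j, 0 <= kap * th ^ j).
{ intros j; apply Rmult_le_pos; [|apply pow_le]; lra. }
assert (Hck : forall k, 0 < c ^ k) by (intros k; apply pow_lt; lra).
assert (Hck1 : forall k, c ^ S k <= c).
{ intros k; assert (c ^ k <= 1) by (rewrite <- (pow1 k); apply pow_incr; lra).
  simpl; nra. }
assert (E2 : forall j, X (S (S j)) * (th * (kap * th ^ j) + X (S (S (S j)))) = X (S j) ^ 2).
{ intros j; rewrite <- (EX (S j)); simpl; ring. }
assert (Inv : forall k, kap * th ^ N k <= (1 - c) * X (N k) /\
                        X (S (N k)) <= c ^ S k * X (N k)).
{ induction k as [|k [I1 I2]]; [simpl; lra|].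
  simpl N; set (j := N k) in *.
  assert (I3 : X (S j) <= c * X j).
  { apply Rle_trans with (1 := I2), Rmult_le_compat_r; [apply Rlt_le, HX | apply Hck1]. }
  destruct (oscillation_step c (kap * th ^ j) (X j) (X (S j)) (X (S (S j)))
    (X (S (S (S j)))) th) as [_ [J1 J2]]; auto.
  split; [simpl; lra|].
  apply Rmult_le_reg_r with (X j); [apply HX|].
  apply Rle_trans with (1 := J1).
  apply Rle_trans with (c * (c ^ S k * X j) * X (S (S j))); [|simpl; lra].
  apply Rmult_le_compat_r; [apply Rlt_le, HX|].
  apply Rmult_le_compat_l; lra. }
assert (Grow : forall k, X (N k) <= c ^ k * X (N (S k))).
{ intros k; destruct (Inv k) as [I1 I2]; simpl N; set (j := N k) in *.
  assert (I3 : X (S j) <= c * X j).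
  { apply Rle_trans with (1 := I2), Rmult_le_compat_r; [apply Rlt_le, HX | apply Hck1]. }
  destruct (oscillation_step c (kap * th ^ j) (X j) (X (S j)) (X (S (S j)))
    (X (S (S (S j)))) th) as [J _]; auto.
  apply Rmult_le_reg_l with (c * X j); [apply Rmult_lt_0_compat; [lra | apply HX]|].
  assert (X (S (S j)) * X (S j) <= X (S (S j)) * (c ^ S k * X j))
    by (apply Rmult_le_compat_l; [apply Rlt_le, HX | assumption]).
  simpl in *; lra. }
(* Two indices allow growth by [a ^ 2]; a rate with an extra factor 1/2 for [/ X (N k)] makes
   [X (N k) * / X (N k)] at most a constant times [(1 / 2) ^ k], although it equals 1. *)
destruct (pow_eventually_lt c 1 (1 / (2 * a ^ 2))) as [N0 HN0]; [lra | lra | |].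
{ apply Rdiv_lt_0_compat; nra. }
assert (Ha2 : 0 < 1 / (2 * a ^ 2)) by (apply Rdiv_lt_0_compat; nra).
destruct (geometric_bound (1 / (2 * a ^ 2)) N0 (fun k => / X (N k)))
  as [C [HC HCn]]; [assumption | | |].
- intros k; apply Rlt_le, Rinv_0_lt_compat, HX.
- intros k Hkk; assert (G := Grow k); specialize (HN0 k Hkk).
  assert (P := HX (N k)); assert (P' := HX (N (S k))).
  apply Rmult_le_reg_r with (X (N k) * X (N (S k))); [nra|].
  replace (/ X (N (S k)) * (X (N k) * X (N (S k)))) with (X (N k)) by (field; lra).
  replace (1 / (2 * a ^ 2) * / X (N k) * (X (N k) * X (N (S k))))
    with (1 / (2 * a ^ 2) * X (N (S k))) by (field; lra).
  nra.
- assert (HM : 0 < M * a ^ n) by (apply Rlt_le_trans with (1 := HX n), HB).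
  destruct (pow_eventually_lt (1 / 2) (C * (M * a ^ n)) 1) as [k Hkk]; [lra | nra | lra |].
  specialize (Hkk k (le_n k)); specialize (HCn k); simpl in HCn.
  assert (B := HB (N k)); assert (P := HX (N k)).
  apply (Rmult_le_compat_r (X (N k))) in HCn; [|lra].
  rewrite Rinv_l in HCn by lra.
  assert (Q : C * (1 / (2 * (a * (a * 1)))) ^ k * X (N k)
           <= C * (1 / (2 * (a * (a * 1)))) ^ k * (M * a ^ N k)).
  { apply Rmult_le_compat_l; [|assumption].
    apply Rmult_le_pos; [lra | apply pow_le; simpl in Ha2; lra]. }
  rewrite HN, pow_add, pow_mult in Q.
  replace (C * (1 / (2 * (a * (a * 1)))) ^ k * (M * (a ^ n * (a ^ 2) ^ k)))
    with (C * (M * a ^ n) * (1 / 2) ^ k) in Q; [rewrite HN in HCn; lra|].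
  replace (1 / 2) with (1 / (2 * (a * (a * 1))) * a ^ 2) by (simpl; field; lra).
  rewrite Rpow_mult_distr; ring.
Qed.

Lemma product_bounded_below (q C : R) (F : nat -> R) :
  0 < q < 1 -> 0 < C -> (forall n, 0 < F n) -> (forall n, F (S n) <= F n) ->
  (forall n, F n * (1 - C * q ^ n) <= F (S n)) ->
  exists d, 0 < d /\ forall n, d <= F n.
Proof.
intros Hq HC HF Hdecr H.
destruct (pow_eventually_lt q C ((1 - q) / 2)) as [N HN]; [lra | lra | lra |].
(* An explicit barrier replaces the infinite product: it decreases from 1 to 1/2, and its steps
   dominate the relative losses [C * q ^ (N + j)] by the choice of [N]. *)
assert (Hlow : forall j, F N * (1 / 2 + q ^ j / 2) <= F (N + j)%nat).
{ induction j as [|j IH]; [rewrite Nat.add_0_r; simpl; specialize (HF N); lra|].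
  rewrite Nat.add_succ_r; apply Rle_trans with (2 := H _).
  assert (A : C * q ^ (N + j) <= (1 - q) / 2 * q ^ j).
  { rewrite pow_add, <- Rmult_assoc; apply Rmult_le_compat_r; [apply pow_le; lra|].
    apply Rlt_le, HN, le_n. }
  assert (B : 0 < q ^ j <= 1).
  { split; [apply pow_lt; lra | rewrite <- (pow1 j); apply pow_incr; lra]. }
  assert (D : 0 < F N) by apply HF; assert (D' := HF (N + j)%nat).
  set (p := q ^ j) in *.
  assert (Z : 1 - (1 - q) / 2 * p <= 1 - C * q ^ (N + j)) by lra.
  apply Rle_trans with (F N * (1 / 2 + p / 2) * (1 - (1 - q) / 2 * p)).
  - simpl; fold p; rewrite Rmult_assoc; apply Rmult_le_compat_l; [lra|].
    assert (0 <= p * (1 - q) * (1 - p)) by (repeat apply Rmult_le_pos; lra). lra.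
  - apply Rmult_le_compat; try lra; nra. }
exists (F N / 2); split; [specialize (HF N); lra|].
intros n; destruct (Nat.le_gt_cases N n) as [Hn|Hn].
- replace n with (N + (n - N))%nat by lia.
  apply Rle_trans with (2 := Hlow _).
  assert (0 < q ^ (n - N)) by (apply pow_lt; lra); specialize (HF N); nra.
- apply Rle_trans with (F N); [specialize (HF N); lra|].
  clear - Hn Hdecr; induction Hn as [|m Hm IH]; [apply Hdecr|].
  apply Rle_trans with (2 := IH), Hdecr.
Qed.

(** The ratio bound [c * X n < X (S n)] lets [X] decay at most like [c ^ n], so viscosity relative
    to [X n] decays like [(th / c) ^ n]. The relative flux losses are then summable. *)
Lemma flux_bounded_below (kap th c a M : R) (X : nat -> R) :
  0 < kap -> 0 < th < c -> c < 1 -> 0 < a -> cascade kap th X ->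
  (forall j, X j <= M * a ^ j) -> kap <= (1 - c) * X 0%nat ->
  exists d, 0 < d /\ forall n, d <= flux X n.
Proof.
intros Hk Hth Hc Ha HC HB H0; assert (HC' := HC); destruct HC' as [HX EX].
assert (Hq : 0 < th / c < 1).
{ split; [apply Rdiv_lt_0_compat; lra | apply Rlt_div_l; lra]. }
assert (Hqn : forall n, 0 < (th / c) ^ n <= 1).
{ intros n; split; [apply pow_lt; lra | rewrite <- (pow1 n); apply pow_incr; lra]. }
assert (HK : forall j, 0 < kap * th ^ j).
{ intros j; apply Rmult_lt_0_compat; [|apply pow_lt]; lra. }
assert (Hrat : forall n, kap * th ^ n <= (1 - c) * X n ->
                 c * X n < X (S n) /\ c * X (S n) <= X n).
{ intros n Hn.
  assert (A : c * X n < X (S n)).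
  { apply Rnot_le_lt; apply (oscillation_blowup kap th c a M); auto; lra. }
  split; [assumption|].
  (* Too large an upward jump is followed by a drop: [X n < c * X (S n)] and the recursion give
     [X (S (S n)) <= c * X (S n)], so the blow-up starts at [S n]. *)
  apply Rnot_lt_le; intros H.
  assert (P := HX n); assert (P' := HX (S n)); assert (K0 := HK n); assert (E := EX n).
  apply (oscillation_blowup kap th c a M X (S n)); auto; try lra.
  - simpl; apply Rle_trans with (kap * th ^ n); nra.
  - apply Rmult_le_reg_l with (X (S n)); [assumption|].
    apply Rle_trans with (X n ^ 2); [nra|].
    apply Rle_trans with ((c * X (S n)) * (c * X (S n))); nra. }
assert (Hm : forall n, kap * th ^ n <= (1 - c) * (th / c) ^ n * X n).
{ induction n as [|n IH]; [simpl; lra|].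
  assert (P := HX n); assert (Q := Hqn n).
  destruct (Hrat n) as [A _].
  { apply Rle_trans with (1 := IH). apply Rmult_le_compat_r; nra. }
  replace (kap * th ^ S n) with (th * (kap * th ^ n)) by (simpl; ring).
  apply Rle_trans with (th * ((1 - c) * (th / c) ^ n * X n)); [nra|].
  replace ((1 - c) * (th / c) ^ S n * X (S n))
    with (th * ((1 - c) * (th / c) ^ n * (X (S n) / c))) by (simpl; field; lra).
  apply Rmult_le_compat_l; [lra|]. apply Rmult_le_compat_l; [nra|].
  apply Rle_div_r; lra. }
apply (product_bounded_below (th / c) ((1 - c) / c)); auto.
- apply Rdiv_lt_0_compat; lra.
- intros n; apply (flux_pos kap th), HC.
- intros n; apply (flux_decr kap th); auto; lra.
- intros n; assert (A := flux_balance _ _ _ n HC).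
  assert (P := HX n); assert (P' := HX (S n)); assert (Q := Hqn n).
  destruct (Hrat n) as [_ B].
  { apply Rle_trans with (1 := Hm n). apply Rmult_le_compat_r; nra. }
  assert (D : kap * th ^ n * X (S n) ^ 2
              <= (1 - c) * (th / c) ^ n * X n * X (S n) ^ 2).
  { apply Rmult_le_compat_r; [nra | apply Hm]. }
  assert (E : (1 - c) * (th / c) ^ n * X n * X (S n) ^ 2
              <= flux X n * ((1 - c) / c * (th / c) ^ n)).
  { unfold flux.
    replace (X n ^ 2 * X (S n) * ((1 - c) / c * (th / c) ^ n))
      with ((1 - c) * (th / c) ^ n * X n * (X (S n) * (X n / c))) by (field; lra).
    apply Rmult_le_compat_l; [apply Rmult_le_pos; [apply Rmult_le_pos|]; lra|].
    replace (X (S n) ^ 2) with (X (S n) * X (S n)) by ring.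
    apply Rmult_le_compat_l; [lra|]. apply Rle_div_r; lra. }
  lra.
Qed.

(** * Passage between the dyadic system and cascades *)

Lemma Rpower_INR (x e : R) (n : nat) : Rpower x (e * INR n) = Rpower x e ^ n.
Proof. rewrite <- Rpower_mult; apply Rpower_pow, exp_pos. Qed.

Definition scale_base (beta : R) : R := Rpower 2 (beta / 3).
Definition dissip_ratio (beta gamma : R) : R := Rpower 2 (gamma - 2 * (beta / 3)).

Lemma scale_base_gt_1 (beta : R) : 0 < beta -> 1 < scale_base beta.
Proof.
intros H; unfold scale_base; rewrite <- (Rpower_O 2) by lra; apply Rpower_lt; lra.
Qed.

Lemma dissip_ratio_pos (beta gamma : R) : 0 < dissip_ratio beta gamma.
Proof. apply exp_pos. Qed.

Lemma k_scale_base (beta : R) (n : nat) : k beta n = (scale_base beta ^ n) ^ 3.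
Proof.
unfold k, scale_base; rewrite <- Rpower_INR, <- (Rpower_pow 3), Rpower_mult by apply exp_pos.
f_equal; simpl; field.
Qed.

Lemma Rpower_2_gamma (beta gamma : R) :
  Rpower 2 gamma = dissip_ratio beta gamma * scale_base beta ^ 2.
Proof.
unfold dissip_ratio, scale_base; rewrite <- (Rpower_pow 2), Rpower_mult, <- Rpower_plus
  by apply exp_pos.
f_equal; simpl; field.
Qed.

Lemma l_dissip_ratio (beta gamma : R) (n : nat) :
  l gamma n = dissip_ratio beta gamma ^ n * (scale_base beta ^ n) ^ 2.
Proof.
unfold l; rewrite Rpower_INR, (Rpower_2_gamma beta), Rpow_mult_distr, <- !pow_mult.
do 2 f_equal; lia.
Qed.

(* [prev] shifts the index, so that [rescaled 0 = f]. *)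
Definition rescaled (beta f : R) (Y : nat -> R -> R) (n : nat) : R :=
  scale_base beta ^ n * prev f Y n 0.

Lemma stationary_rhs_zero (f nu beta gamma : R) (Y : nat -> R -> R) (n : nat) :
  stationary_positive_l2_solution f nu beta gamma Y ->
  dyadic_rhs f nu beta gamma Y n 0 = 0.
Proof.
intros [[HC _] HS].
destruct (HC n) as [Y' [HD [_ HE]]].
rewrite <- HE by lra.
destruct (Req_dec (Y' 0) 0) as [|Hne]; [assumption|exfalso].
(* [Y n] is constant on [[0, oo)] only, so the one-sided difference quotient at [d / 2] is used: it
   is 0, at distance exactly [Rabs (Y' 0)] from the derivative. *)
destruct (HD 0 (Rle_refl 0) (Rabs (Y' 0))) as [d [Hd H]]; [apply Rabs_pos_lt, Hne|].
specialize (H (d / 2)); simpl in H; unfold Rdist in H.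
rewrite (HS n (d / 2) 0) in H by lra.
replace ((Y n 0 - Y n 0) / (d / 2 - 0) - Y' 0) with (- Y' 0) in H by (field; lra).
rewrite Rabs_Ropp in H.
apply (Rlt_irrefl (Rabs (Y' 0))), H; split.
- unfold D_x, nonneg_reals; lra.
- rewrite Rminus_0_r, Rabs_pos_eq; lra.
Qed.

Lemma stationary_cascade (f nu beta gamma : R) (Y : nat -> R -> R) :
  0 < beta -> 0 < f -> stationary_positive_l2_solution f nu beta gamma Y ->
  cascade (nu / scale_base beta) (dissip_ratio beta gamma) (rescaled beta f Y).
Proof.
intros Hb Hf HY.
assert (Ha := scale_base_gt_1 _ Hb).
assert (HE := fun n => stationary_rhs_zero _ _ _ _ _ n HY).
unfold dyadic_rhs in HE.
(* Strict positivity propagates from [f]: if [Y n] vanished, the equation would reduce to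
   [k beta n * prev f Y n 0 ^ 2 = 0]. *)
assert (Hpos : forall n, 0 < prev f Y n 0).
{ induction n as [|n IH]; [exact Hf|]; simpl.
  destruct HY as [[_ [_ HP]] _]; destruct (HP n 0 (Rle_refl 0)) as [|Z]; [assumption|].
  specialize (HE n); rewrite <- Z in HE.
  assert (0 < k beta n * prev f Y n 0 ^ 2); [|lra].
  apply Rmult_lt_0_compat; [apply exp_pos | apply pow_lt, IH]. }
split.
- intros n; apply Rmult_lt_0_compat; [apply pow_lt; lra | apply Hpos].
- intros n; specialize (HE n).
  rewrite !(k_scale_base beta), (l_dissip_ratio beta) in HE; unfold rescaled; simpl pow in *; simpl prev.
  set (a := scale_base beta) in *; set (th := dissip_ratio beta gamma) in *.
  assert (0 < a ^ n) by (apply pow_lt; lra).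
  apply Rmult_eq_reg_l with (a ^ n); [|lra].
  apply Ropp_eq_0_compat in HE.
  apply Rminus_diag_uniq, eq_trans with (2 := HE); field; lra.
Qed.

Lemma rescaled_bound (f nu beta gamma : R) (Y : nat -> R -> R) :
  0 < beta -> stationary_positive_l2_solution f nu beta gamma Y ->
  exists M, forall n, rescaled beta f Y n <= M * scale_base beta ^ n.
Proof.
intros Hb [[_ [HS HP]] _]; assert (Ha := scale_base_gt_1 _ Hb).
destruct (filterlim_bounded (fun n => Y n 0 ^ 2)) as [M HM].
{ exists 0; apply (ex_series_lim_0 (fun n => Y n 0 ^ 2)), HS, Rle_refl. }
(* [f] covers index 0; elsewhere [y ^ 2 <= M] implies [y <= 1 + M]. *)
exists (Rmax f (1 + M)); intros n; unfold rescaled; rewrite Rmult_comm.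
apply Rmult_le_compat_r; [apply pow_le; lra|].
destruct n as [|n]; [apply Rmax_l|]; simpl.
apply Rle_trans with (2 := Rmax_r _ _).
assert (A := Rle_trans _ _ _ (Rle_abs _) (HM n)); nra.
Qed.

Lemma cascade_stationary (f nu beta gamma : R) (X : nat -> R) :
  0 < beta -> cascade (nu / scale_base beta) (dissip_ratio beta gamma) X -> X 0%nat = f ->
  ex_series (fun n => (X (S n) / scale_base beta ^ S n) ^ 2) ->
  stationary_positive_l2_solution f nu beta gamma
    (fun n _ => X (S n) / scale_base beta ^ S n).
Proof.
intros Hb [HX EX] H0 HS; assert (Ha := scale_base_gt_1 _ Hb).
assert (Han : forall n, 0 < scale_base beta ^ n) by (intros n; apply pow_lt; lra).
split; [split; [|split]|].
- intros n; exists (fun _ => 0); split; [|split].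
  + intros t _; apply Dconst.
  + intros t _ e He; exists 1; split; [lra|].
    intros x _; simpl; unfold Rdist; rewrite Rminus_0_r, Rabs_R0; assumption.
  + intros t _; unfold dyadic_rhs.
    replace (prev f _ n t) with (X n / scale_base beta ^ n).
    2:{ destruct n; simpl; [rewrite H0; field | reflexivity]. }
    assert (A := Han n); specialize (EX n); rewrite !(k_scale_base beta), (l_dissip_ratio beta).
    simpl pow in *; set (a := scale_base beta) in *.
    replace (a ^ n * (a ^ n * (a ^ n * 1)) *
       (X n / a ^ n * (X n / a ^ n * 1))) with (a ^ n * (X n * (X n * 1))) by (field; lra).
    rewrite <- EX; field; lra.
- intros t _; exact HS.
- intros n t _; apply Rlt_le, Rdiv_lt_0_compat; [apply HX | apply Han].
- intros n s t _ _; reflexivity.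
Qed.

(** Since [th * a ^ 2 = 2 ^ gamma >= 1], the energy of each mode is at most a constant times its
    dissipation, which is summable. *)
Lemma cascade_square_summable (nu beta gamma : R) (X : nat -> R) :
  0 < nu -> 0 < beta -> 0 < gamma ->
  cascade (nu / scale_base beta) (dissip_ratio beta gamma) X ->
  ex_series (fun n => (X (S n) / scale_base beta ^ S n) ^ 2).
Proof.
intros Hn Hb Hg HX; assert (Ha := scale_base_gt_1 _ Hb).
assert (Hth := dissip_ratio_pos beta gamma).
set (a := scale_base beta) in *; set (th := dissip_ratio beta gamma) in *.
assert (Hk : 0 < nu / a) by (apply Rdiv_lt_0_compat; lra).
assert (Hl : 1 <= th * a ^ 2).
{ unfold th, a; rewrite <- Rpower_2_gamma, <- (Rpower_O 2) by lra.
  apply Rle_Rpower; lra. }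
assert (H := ex_series_scal (/ (nu / a * a ^ 2)) _
               (cascade_dissipation_summable _ _ _ (Rlt_le _ _ Hk) Hth HX)).
refine (ex_series_le (K := R_AbsRing) (V := R_CompleteNormedModule) _ _ _ H).
intros n; change (Rabs ((X (S n) / a ^ S n) ^ 2)
  <= / (nu / a * a ^ 2) * (nu / a * th ^ n * X (S n) ^ 2)).
rewrite Rabs_pos_eq by apply pow2_ge_0.
assert (Han : 0 < a ^ n) by (apply pow_lt; lra).
assert (A : 1 <= th ^ n * (a ^ n) ^ 2).
{ replace (th ^ n * (a ^ n) ^ 2) with ((th * a ^ 2) ^ n); [apply pow_R1_Rle, Hl|].
  rewrite Rpow_mult_distr, <- !pow_mult; do 2 f_equal; lia. }
replace (/ (nu / a * a ^ 2) * (nu / a * th ^ n * X (S n) ^ 2))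
  with ((X (S n) / a ^ S n) ^ 2 * (th ^ n * (a ^ n) ^ 2)) by (simpl; field; lra).
rewrite <- (Rmult_1_r ((X (S n) / a ^ S n) ^ 2)) at 1.
apply Rmult_le_compat_l; [apply pow2_ge_0 | assumption].
Qed.

Lemma constant_square_summable (a f : R) :
  1 < a -> ex_series (fun n => (f / a ^ S n) ^ 2).
Proof.
intros Ha; assert (Hi : 0 < / a < 1).
{ split; [apply Rinv_0_lt_compat; lra | rewrite <- Rinv_1; apply Rinv_lt_contravar; lra]. }
apply ex_series_ext with (fun n => scal ((f / a) ^ 2) ((/ a ^ 2) ^ n)).
- intros n; change (scal ((f / a) ^ 2) ((/ a ^ 2) ^ n)) with ((f / a) ^ 2 * (/ a ^ 2) ^ n).
  rewrite pow_inv, <- pow_mult, Nat.mul_comm, pow_mult; simpl; field.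
  split; [apply pow_nonzero|]; lra.
- apply (ex_series_scal (V := R_NormedModule)), ex_series_geom.
  rewrite <- pow_inv, Rabs_pos_eq; simpl; nra.
Qed.

(** * Conservation, uniqueness, existence and regularity of stationary solutions *)

Lemma RInt_constant_on_nonneg (g : R -> R) (c s t : R) :
  0 <= s -> s < t -> (forall u, 0 <= u -> g u = c) -> RInt g s t = (t - s) * c.
Proof.
intros Hs Hst H; rewrite (RInt_ext _ (fun _ => c)); [apply (RInt_const (V := R_CompleteNormedModule))|].
intros x Hx; rewrite Rmin_left in Hx by lra; apply H; lra.
Qed.

(** The energies at [s] and [t] agree, so the balance says that the total dissipation equals the
    input. Both are flux quantities times [r]: the dissipation telescopes to [F 0] minus the limit
    of [F], and the input is [F 0]. *)
Lemma conservative_on_iff (f nu beta gamma s t : R) (Y : nat -> R -> R) :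
  0 < beta -> 0 < f -> stationary_positive_l2_solution f nu beta gamma Y ->
  0 <= s -> s < t ->
  conservative_on f nu gamma Y s t <-> is_lim_seq (flux (rescaled beta f Y)) 0.
Proof.
intros Hb Hf HY Hs Hst; assert (Ha := scale_base_gt_1 _ Hb).
assert (HX := stationary_cascade _ _ _ _ _ Hb Hf HY).
destruct HY as [_ HY].
set (F := flux (rescaled beta f Y)); set (r := (t - s) / scale_base beta).
assert (Hr : 0 < r) by (apply Rdiv_lt_0_compat; lra).
set (D := fun n => nu * (l gamma n * RInt (fun u => Y n u ^ 2) s t)).
assert (HD : forall n, D n = r * (F n - F (S n))).
{ intros n; unfold F; rewrite (flux_balance _ _ _ n HX); unfold D, r.
  rewrite (RInt_constant_on_nonneg _ (Y n 0 ^ 2)); try assumption.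
  2:{ intros u Hu; rewrite (HY n u 0); lra. }
  rewrite (l_dissip_ratio beta); unfold rescaled; simpl; field; lra. }
assert (HF0 : 2 * f ^ 2 * RInt (Y 0%nat) s t = 2 * (r * F 0%nat)).
{ rewrite (RInt_constant_on_nonneg _ (Y 0%nat 0)); try assumption.
  2:{ intros u Hu; rewrite (HY 0%nat u 0); lra. }
  unfold F, flux, rescaled, r; simpl; field; lra. }
assert (HEn : energy Y t = energy Y s).
{ apply Series_ext; intros n; rewrite (HY n t s); lra. }
unfold conservative_on; fold D; rewrite HF0, HEn; split.
- intros [[z Hz] H]; rewrite (is_series_unique _ _ Hz) in H.
  assert (Hz' : z = r * F 0%nat) by lra; rewrite Hz' in Hz.
  replace 0 with (F 0%nat - F 0%nat) by ring.
  apply telescope_limit.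
  apply (is_series_scal (/ r)) in Hz.
  replace (F 0%nat) with (scal (/ r) (r * F 0%nat)).
  2:{ unfold scal; simpl; unfold mult; simpl; field; lra. }
  apply is_series_ext with (2 := Hz).
  intros n; rewrite HD; unfold scal; simpl; unfold mult; simpl; field; lra.
- intros H; apply is_series_telescope, (is_series_scal r) in H.
  assert (H' : is_series D (r * (F 0%nat - 0))).
  { apply is_series_ext with (2 := H); intros n; symmetry; apply HD. }
  split; [eexists; exact H'|].
  rewrite (is_series_unique _ _ H'); ring.
Qed.

Lemma stationary_unique (f nu beta gamma : R) (Y Z : nat -> R -> R) :
  0 <= nu -> 0 < beta -> 0 < f ->
  stationary_positive_l2_solution f nu beta gamma Y ->
  stationary_positive_l2_solution f nu beta gamma Z ->
  forall n t, 0 <= t -> Z n t = Y n t.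
Proof.
intros Hn Hb Hf HY HZ n t Ht; assert (Ha := scale_base_gt_1 _ Hb).
destruct (rescaled_bound _ _ _ _ _ Hb HY) as [M HM].
destruct (rescaled_bound _ _ _ _ _ Hb HZ) as [M' HM'].
assert (H : rescaled beta f Y (S n) = rescaled beta f Z (S n)).
{ apply (cascade_unique (nu / scale_base beta) (dissip_ratio beta gamma) (scale_base beta) M M');
    auto using stationary_cascade, dissip_ratio_pos.
  - apply Rdiv_le_0_compat; lra.
  - lra. }
apply Rmult_eq_reg_l in H; [|apply pow_nonzero; lra]; simpl in H.
rewrite (proj2 HZ n t 0), (proj2 HY n t 0) by lra; auto.
Qed.

Lemma inviscid_stationary (f beta gamma : R) :
  0 < beta -> 0 < f ->
  stationary_positive_l2_solution f 0 beta gamma (fun n _ => f / scale_base beta ^ S n).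
Proof.
intros Hb Hf; apply (cascade_stationary f 0 beta gamma (fun _ => f)); auto.
- split; [auto|]; intros n; unfold Rdiv; ring.
- apply constant_square_summable, scale_base_gt_1, Hb.
Qed.

Lemma stationary_exists (f nu beta gamma : R) :
  0 <= nu -> 0 < beta -> 0 < gamma -> 0 < f ->
  exists Y, stationary_positive_l2_solution f nu beta gamma Y.
Proof.
intros [Hn|<-] Hb Hg Hf; [|eexists; apply inviscid_stationary; assumption].
assert (Ha := scale_base_gt_1 _ Hb).
destruct (cascade_exists_viscous (nu / scale_base beta) (dissip_ratio beta gamma) f)
  as [X [HX H0]]; auto using dissip_ratio_pos.
{ apply Rdiv_lt_0_compat; lra. }
eexists; apply (cascade_stationary _ _ _ _ _ Hb HX H0).
apply (cascade_square_summable nu beta gamma); assumption.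
Qed.

Lemma stationary_regular (f nu beta gamma : R) (Y : nat -> R -> R) :
  0 < nu -> 0 < beta -> 1 <= dissip_ratio beta gamma -> 0 < f ->
  stationary_positive_l2_solution f nu beta gamma Y -> regular Y.
Proof.
intros Hn Hb Hth Hf HY s t Ht; assert (Ha := scale_base_gt_1 _ Hb).
set (p := Rpower 2 s); assert (Hp : 0 < p) by apply exp_pos.
(* The rate [/ (2 * p)] beats the weight [p ^ n] with a factor [(1 / 2) ^ n] to spare, which squares
   to the geometric series of ratio 1/4. *)
assert (Hpi : 0 < / (2 * p)) by (apply Rinv_0_lt_compat; lra).
assert (HX := stationary_cascade _ _ _ _ _ Hb Hf HY).
assert (Hk : 0 < nu / scale_base beta) by (apply Rdiv_lt_0_compat; lra).
destruct (cascade_superexponential _ _ _ Hk Hth HX _ Hpi) as [C [HC HCn]].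
assert (H : ex_series (fun n => scal ((C * / (2 * p)) ^ 2) ((1 / 4) ^ n))).
{ apply (ex_series_scal (V := R_NormedModule)), ex_series_geom.
  rewrite Rabs_pos_eq; lra. }
refine (ex_series_le (K := R_AbsRing) (V := R_CompleteNormedModule) _ _ _ H).
intros n; change (Rabs ((Rpower 2 (s * INR n) * Y n t) ^ 2)
  <= (C * / (2 * p)) ^ 2 * (1 / 4) ^ n).
rewrite Rabs_pos_eq by apply pow2_ge_0.
rewrite Rpower_INR; fold p.
assert (Hpn : 0 < p ^ n) by (apply pow_lt, Hp).
replace ((C * / (2 * p)) ^ 2 * (1 / 4) ^ n) with ((p ^ n * (C * (/ (2 * p)) ^ S n)) ^ 2).
2:{ replace (1 / 4) with ((p * / (2 * p)) * (p * / (2 * p))) by (field; lra).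
    rewrite !Rpow_mult_distr; simpl; ring. }
rewrite (proj2 HY n t 0) by lra.
assert (P := proj2 (proj2 (proj1 HY)) n 0 (Rle_refl 0)); simpl in P.
apply pow_incr; split; [apply Rmult_le_pos; lra|].
apply Rmult_le_compat_l; [lra|].
apply Rle_trans with (2 := HCn (S n)); unfold rescaled; simpl prev.
rewrite <- (Rmult_1_l (Y n 0)) at 1.
apply Rmult_le_compat_r; [assumption | apply pow_R1_Rle; lra].
Qed.

(** Regularity with exponent [beta / 3] is exactly square summability of the rescaled sequence, up
    to the factor [scale_base beta]. *)
Lemma regular_flux_vanishes (beta f : R) (Y : nat -> R -> R) :
  regular Y -> is_lim_seq (flux (rescaled beta f Y)) 0.
Proof.
intros H; specialize (H (beta / 3) 0 (Rle_refl 0)).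
apply flux_to_zero, is_lim_seq_incr_1.
apply ex_series_lim_0 in H.
apply is_lim_seq_spec in H; apply is_lim_seq_spec; intros [e He]; simpl.
set (a := scale_base beta); assert (Ha : 0 < a) by apply exp_pos.
assert (Hd : 0 < (e / a) ^ 2) by (apply pow_lt, Rdiv_lt_0_compat; assumption).
destruct (H (mkposreal _ Hd)) as [N HN]; simpl in HN; exists N; intros n Hn.
specialize (HN n Hn); rewrite Rpower_INR in HN; fold (scale_base beta) in HN; fold a in HN.
rewrite Rminus_0_r in *; unfold rescaled; fold a; simpl.
set (x := a ^ n * Y n 0) in *; rewrite !Rmult_1_r in HN.
replace (a * a ^ n * Y n 0) with (a * x) by (unfold x; ring).
rewrite Rabs_mult, (Rabs_pos_eq a) by lra.
rewrite Rmult_comm; apply Rlt_div_r; [assumption|].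
rewrite <- (Rabs_pos_eq (e / a)) by (apply Rlt_le, Rdiv_lt_0_compat; assumption).
apply Rsqr_lt_abs_0; unfold Rsqr.
rewrite Rabs_mult in HN; assert (Q := Rabs_pos x).
apply Rle_lt_trans with (2 := HN); rewrite <- Rabs_mult; apply Rle_abs.
Qed.

Theorem theorem2p2 :
  forall nu beta gamma : R, 0 <= nu -> 0 < beta -> 0 < gamma ->
  (forall f : R, 0 < f ->
     exists Y : nat -> R -> R,
       stationary_positive_l2_solution f nu beta gamma Y /\
       forall Z : nat -> R -> R,
         stationary_positive_l2_solution f nu beta gamma Z ->
         forall (n : nat) (t : R), 0 <= t -> Z n t = Y n t) /\
  (nu = 0 ->
     forall (f : R) (Y : nat -> R -> R), 0 < f ->
       stationary_positive_l2_solution f nu beta gamma Y ->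
       forall (n : nat) (t : R), 0 <= t ->
         Y n t = f * Rpower 2 (- (beta / 3) * (INR n + 1))) /\
  (0 < nu -> 3 * gamma >= 2 * beta ->
     forall (f : R) (Y : nat -> R -> R), 0 < f ->
       stationary_positive_l2_solution f nu beta gamma Y ->
       conservative f nu gamma Y /\ regular Y) /\
  (0 < nu -> 3 * gamma < 2 * beta ->
     exists C : R, 0 < C /\
       forall (f : R) (Y : nat -> R -> R), C < f ->
         stationary_positive_l2_solution f nu beta gamma Y ->
         ~ regular Y /\ anomalous_dissipation f nu gamma Y).
Proof.
intros nu beta gamma Hnu Hb Hg; assert (Ha := scale_base_gt_1 _ Hb).
split; [|split; [|split]].
- intros f Hf; destruct (stationary_exists f nu beta gamma) as [Y HY]; auto.
  exists Y; split; [assumption|]; intros Z HZ.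
  apply (stationary_unique f nu beta gamma); assumption.
- intros -> f Y Hf HY n t Ht.
  rewrite (stationary_unique f 0 beta gamma _ _ Hnu Hb Hf
             (inviscid_stationary f beta gamma Hb Hf) HY) by assumption.
  rewrite <- S_INR, Ropp_mult_distr_l_reverse, Rpower_Ropp, Rpower_INR; reflexivity.
- intros Hn Hge f Y Hf HY.
  assert (Hth : 1 <= dissip_ratio beta gamma).
  { unfold dissip_ratio; rewrite <- (Rpower_O 2) by lra; apply Rle_Rpower; lra. }
  assert (HR : regular Y) by (apply (stationary_regular f nu beta gamma); assumption).
  split; [|assumption].
  intros s t Hs Hst; apply (conservative_on_iff f nu beta gamma); auto.
  apply regular_flux_vanishes, HR.
- intros Hn Hlt.
  assert (Hth0 := dissip_ratio_pos beta gamma).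
  assert (Hth : dissip_ratio beta gamma < 1).
  { unfold dissip_ratio; rewrite <- (Rpower_O 2) by lra; apply Rpower_lt; lra. }
  (* The midpoint between [th] and 1 depends on neither [f] nor [Y], so neither does the threshold
     [kap / (1 - c)], which encodes [kap <= (1 - c) * X 0]. *)
  set (c := (1 + dissip_ratio beta gamma) / 2).
  assert (Hc : dissip_ratio beta gamma < c < 1) by (unfold c; lra).
  set (kap := nu / scale_base beta).
  assert (Hk : 0 < kap) by (apply Rdiv_lt_0_compat; lra).
  exists (kap / (1 - c)); split; [apply Rdiv_lt_0_compat; lra|].
  intros f Y HCf HY.
  assert (Hf : 0 < f).
  { apply Rlt_trans with (2 := HCf); apply Rdiv_lt_0_compat; lra. }
  assert (Hno : ~ is_lim_seq (flux (rescaled beta f Y)) 0).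
  { destruct (rescaled_bound _ _ _ _ _ Hb HY) as [M HM].
    destruct (flux_bounded_below kap (dissip_ratio beta gamma) c (scale_base beta) M
      (rescaled beta f Y)) as [d [Hd HF]]; auto; try lra.
    - apply stationary_cascade; assumption.
    - apply Rlt_div_l in HCf; [|lra]; unfold rescaled; simpl; lra.
    - intros H; assert (D := is_lim_seq_le _ _ _ _ HF (is_lim_seq_const d) H).
      simpl in D; lra. }
  split.
  + intros HR; apply Hno, regular_flux_vanishes, HR.
  + intros s t Hs Hst H; apply Hno.
    apply (conservative_on_iff f nu beta gamma s t); assumption.
Qed.
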